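(* Let $\mathcal E$ and $\mathcal F$ be two functionals defined on a linear space $X$ for which the functional inequality $\mathcal E(x)\le\mathcal F(x)$ for all $x\in X$ holds and is sharp, i.e. the set of optimizers $X_0=\{x\in X:\mathcal E(x)=\mathcal F(x)<\infty\}$ is nonempty. Assume that $\mathcal E$ and $\mathcal F$ are both $p$-homogeneous, i.e. $\mathcal E(\lambda x)=\lambda^p\mathcal E(x)$ and $\mathcal F(\lambda x)=\lambda^p\mathcal F(x)$ for all $\lambda>0$. Let $d$ be a distance on $X$ with $d(x,X_0)\not\equiv0$ and $d(\lambda x,\lambda y)=\lambda d(x,y)$ for all $\lambda>0$ and $x,y\in X$. Then: (i) If $q\neq p$, there is no global stable inequality of the form $$\mathcal F(x)-\mathcal E(x)\ge c\,d^{q}(x,X_0)\quad\text{for all }x\in X$$ with a constant $c>0$. If $q<p$, then for $x\in X$ with $0<d(x,X_0)$ small enough there exists no local stable inequality of the form $$\mathcal F(x)-\mathcal E(x)\ge c\,d^{q}(x,X_0)+o(d^{q}(x,X_0))$$ with a constant $c>0$. (ii) The local stable inequality $$\mathcal F(x)-\mathcal E(x)\ge c\,d^{p}(x,X_0)+o(d^{p}(x,X_0))$$ implies the global stable inequality $$\mathcal F(x)-\mathcal E(x)\ge c\,d^{p}(x,X_0).$$ Moreover, if $c_0$ is the optimal constant of this local stable inequality, then it is also the optimal constant of this global stable inequality.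
   Context: Here $d(x,X_0)$ denotes the distance from $x$ to the set $X_0$; the metric $d$ need not be induced by a norm. By homogeneity, $\lambda x_0\in X_0$ whenever $x_0\in X_0$ and $\lambda>0$. A global stable inequality is required for all $x\in X$. In a local stable inequality, the remainder $o(d^{q}(x,X_0))$ is understood as $d(x,X_0)\to0$, with the inequality holding for all such $x\in X$.
   Formalization: Part (i) additionally assumes that some x with d(x,X_0)≠0 has E(x) and F(x) both finite; without it (i) fails, e.g. X=R, E=0, F(0)=0 and F=+∞ elsewhere. For real-valued functionals this is the original assumption d(x,X_0)≢0. *)

(* Defs.v *)
From HB Require Import structures.
From mathcomp Require Import all_boot all_order all_algebra.
From mathcomp Require Import all_classical all_reals all_analysis.

Set Implicit Arguments.
Unset Strict Implicit.
Unset Printing Implicit Defensive.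

Import Order.TTheory GRing.Theory Num.Theory.
Import numFieldNormedType.Exports.

Local Open Scope classical_set_scope.
Local Open Scope ring_scope.
Local Open Scope ereal_scope.

(* The library's [metricType] would put a topology on the carrier; here the
   distance is only a function on a linear space, unrelated to any norm. *)
Record is_distance (R : realType) (X : Type) (d : X -> X -> R) : Prop :=
  IsDistance {
    dist_xx : forall x, d x x = 0%R ;
    dist_eq : forall x y, d x y = 0%R -> x = y ;
    dist_sym : forall x y, d x y = d y x ;
    dist_triangle : forall x y z, (d x z <= d x y + d y z)%R }.

Definition scaling_distance (R : realType) (X : lmodType R)
    (d : X -> X -> R) : Prop :=
  forall (l : R) (x y : X), (0 < l)%R -> d (l *: x)%R (l *: y)%R = (l * d x y)%R.

(* [p] is an arbitrary real number, [l `^ p] is the real power. *)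
Definition homogeneous (R : realType) (X : lmodType R) (p : R)
    (E : X -> \bar R) : Prop :=
  forall (l : R) (x : X), (0 < l)%R -> E (l *: x)%R = (l `^ p)%:E * E x.

Definition optimizers (R : realType) (X : lmodType R)
    (E F : X -> \bar R) : set X :=
  [set x | E x = F x /\ F x < +oo].

(* Only used for nonempty [A]; for empty [A] the library's [inf] gives 0. *)
Definition set_dist (R : realType) (X : Type) (d : X -> X -> R)
    (A : set X) (x : X) : R :=
  inf [set d x y | y in A].

(* In the two inequalities below, [F x - E x >= s] with [s] real is written
   [E x + s <= F x], so that no difference of infinities occurs; it then holds
   wherever [F x = +oo]. At distance 0 the library's real power gives
   [0 `^ q = 0] for [q != 0] and [0 `^ 0 = 1]. *)
Definition global_stable (R : realType) (X : lmodType R)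
    (E F : X -> \bar R) (d : X -> X -> R) (q c : R) : Prop :=
  forall x, E x + (c * set_dist d (optimizers E F) x `^ q)%:E <= F x.

(* The filter "d(x, A) tends to 0 with x in D". *)
Definition near_set (R : realType) (X : Type) (d : X -> X -> R)
    (A D : set X) : set_system X :=
  within D (filter_from [set e : R | (0 < e)%R]
                        (fun e => [set x | (set_dist d A x < e)%R])).

Global Instance near_set_filter (R : realType) (X : Type) (d : X -> X -> R)
  (A D : set X) : Filter (near_set d A D).
Proof.
apply: within_filter; apply: filter_from_filter; first by exists 1%R; rewrite /= ltr01.
move=> i j /= i0 j0; exists (Num.min i j); first by rewrite /= lt_min i0 j0.
by move=> x /=; rewrite lt_min => /andP[].
Qed.

Canonical near_set_filter_on (R : realType) (X : Type) (d : X -> X -> R)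
  (A D : set X) := FilterType (near_set d A D) (near_set_filter d A D).

(* [D] is the set of points at which the inequality is considered. *)
Definition local_stable (R : realType) (X : lmodType R)
    (E F : X -> \bar R) (d : X -> X -> R) (D : set X) (q c : R) : Prop :=
  let dX0 := set_dist d (optimizers E F) in
  let nearX0 := near_set d (optimizers E F) D in
  exists r : X -> R^o,
    r =o_nearX0 ((fun x => (dX0 x `^ q)%R) : X -> R^o) /\
    \forall x \near nearX0, E x + (c * dX0 x `^ q + r x)%:E <= F x.

Definition optimal_constant (R : realType) (P : R -> Prop) (c0 : R) : Prop :=
  [/\ (0 < c0)%R, P c0 & forall c, (0 < c)%R -> P c -> (c <= c0)%R].

(* Main.v *)
(** Every term of the inequality scales under dilation: the deficit [F - E] like
    [l `^ p] and the [q]-th power of the distance like [l `^ q]. Evaluated along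
    a ray [l *: x], a stable inequality with exponent [q] thus becomes the
    inequality at [x] with the constant multiplied by [l `^ (q - p)]. This
    factor is unbounded if [q != p], and already unbounded for small [l] if
    [q < p]; for [q = p] it is [1], and letting [l] tend to 0 removes the
    remainder. *)

Require Import Defs.
From HB Require Import structures.
From mathcomp Require Import all_boot all_order all_algebra.
From mathcomp Require Import all_classical all_reals all_analysis.
From mathcomp Require Import ring.

Import Order.TTheory GRing.Theory Num.Theory.
Import numFieldNormedType.Exports.

Local Open Scope classical_set_scope.
Local Open Scope ring_scope.

Lemma powR_unbounded (R : realType) (s M : R) :
  s != 0 -> exists2 l : R, 0 < l & M < l `^ s.
Proof.
move=> s0; have t0 : 0 < `|M| + 1 by rewrite ltr_wpDl.
exists ((`|M| + 1) `^ s^-1); first exact: powR_gt0.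
by rewrite -powRrM mulVf// powRr1 ?ltW// (le_lt_trans (ler_norm M))// ltrDl.
Qed.

(** For negative [s] the power is decreasing in its base, so asking that [l]^ s[also exceed]e [^ s]
    forces [l < e]. *)
Lemma powR_unbounded_near0 (R : realType) (s M e : R) :
  s < 0 -> 0 < e -> exists l : R, [/\ 0 < l, l < e & M < l `^ s].
Proof.
move=> s0 e0.
have [l l0 Ml] := powR_unbounded _ s (Num.max M (e `^ s)) (ltr0_neq0 s0).
move: Ml; rewrite gt_max => /andP[Ml el].
exists l; split=> //; rewrite ltNge; apply/negP => le_el.
move: el; rewrite -(opprK s) (powRN e) (powRN l) ltf_pV2 ?posrE ?powR_gt0// ltNge.
by rewrite ge0_ler_powR// ?nnegrE ?oppr_ge0 ltW.
Qed.

(** Since [s] is real, the factor [k] distributes over the sum and cancels even when [a] or [b] is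
    infinite. *)
Lemma lee_pmul2l_addr (R : realType) (k s : R) (a b : \bar R) : 0 < k ->
  (k%:E * a + (k * s)%:E <= k%:E * b)%E = (a + s%:E <= b)%E.
Proof.
by move=> k0; rewrite EFinM -muleDr ?fin_num_adde_defl// lee_pmul2l ?lte_fin.
Qed.

Lemma dist_ge0 (R : realType) (X : Type) (d : X -> X -> R) (x y : X) :
  is_distance d -> 0 <= d x y.
Proof.
move=> dd; have := dist_triangle dd x y x.
by rewrite (dist_xx dd) (dist_sym dd y x) -mulr2n pmulrn_lge0.
Qed.

Section set_dist_cone.
Context (R : realType) (X : lmodType R) (d : X -> X -> R) (A : set X).
Hypotheses (dd : is_distance d) (sd : scaling_distance d).
Hypothesis A0 : A !=set0.
Hypothesis Acone : forall (l : R) (y : X), 0 < l -> A y -> A (l *: y).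

Lemma set_dist_le x y : A y -> set_dist d A x <= d x y.
Proof.
move=> Ay; apply: ge_inf; last by exists y.
by exists 0 => _ [z _ <-]; exact: dist_ge0.
Qed.

Lemma set_dist_ge0 x : 0 <= set_dist d A x.
Proof.
apply: lb_le_inf => [|_ [z _ <-]]; last exact: dist_ge0.
by have [y Ay] := A0; exists (d x y), y.
Qed.

(** Dilation sends each competitor [y] for [x] to a competitor [l *: y] for [l *: x], at [l] times
    the distance. *)
Lemma set_distZ_le (l : R) x : 0 < l -> set_dist d A (l *: x) <= l * set_dist d A x.
Proof.
move=> l0; rewrite mulrC -ler_pdivrMr//; apply: lb_le_inf.
  by have [y Ay] := A0; exists (d x y), y.
move=> _ [y Ay <-]; rewrite ler_pdivrMr// mulrC -sd//.
exact/set_dist_le/Acone.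
Qed.

Lemma set_distZ (l : R) x : 0 < l -> set_dist d A (l *: x) = l * set_dist d A x.
Proof.
move=> l0; apply/eqP; rewrite eq_le set_distZ_le//=.
(* The reverse bound is the same inequality for the dilation by [l^-1] at the point [l *: x]. *)
rewrite mulrC -ler_pdivlMr// mulrC -[in leLHS](scalerK (lt0r_neq0 l0) x).
by rewrite set_distZ_le// invr_gt0.
Qed.

End set_dist_cone.

Section stability.
Context (R : realType) (X : lmodType R) (E F : X -> \bar R) (p : R)
  (d : X -> X -> R).
Hypotheses (homE : homogeneous p E) (homF : homogeneous p F).
Hypotheses (dd : is_distance d) (sd : scaling_distance d).
Hypothesis sharp : optimizers E F !=set0.

Local Notation dX0 := (set_dist d (optimizers E F)).

Lemma optimizers_cone (l : R) x :
  0 < l -> optimizers E F x -> optimizers E F (l *: x).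
Proof.
move=> l0 [EFx Fx]; split; first by rewrite homE// homF// EFx.
by rewrite homF// lte_mul_pinfty// lee_fin powR_ge0.
Qed.

Let dX0Z l x : 0 < l -> dX0 (l *: x) = l * dX0 x.
Proof. by apply: set_distZ => // ? ?; exact: optimizers_cone. Qed.

Lemma stable_ray (q c l : R) x : 0 < l ->
  (E (l *: x) + (c * dX0 (l *: x) `^ q)%:E <= F (l *: x))%E =
  (E x + (c * dX0 x `^ q * l `^ (q - p))%:E <= F x)%E.
Proof.
move=> l0; have lp0 := powR_gt0 p l0.
rewrite homE// homF// dX0Z// powRM ?set_dist_ge0 ?(ltW l0)//.
rewrite -[RHS](lee_pmul2l_addr _ _ _ _ _ lp0).
rewrite powRB; last by apply/implyP => _; rewrite lt0r_neq0.
by congr (_ + _%:E <= _)%E; field; rewrite lt0r_neq0.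
Qed.

Lemma global_stable_local (D : set X) (q c : R) :
  global_stable E F d q c -> local_stable E F d D q c.
Proof.
move=> gs; exists (fun=> 0); split; last first.
  by apply: nearW => x; rewrite addr0; exact: gs.
apply/eqoP => e e0; apply: nearW => x.
by rewrite normr0 mulr_ge0// ltW.
Qed.

(** Near [X0] the remainder is at most [e] times the power of the distance, so it can be traded for
    a loss of [e] in the constant. *)
Lemma local_stable_absorb (D : set X) (q c e : R) : 0 < e ->
  local_stable E F d D q c ->
  exists2 del, 0 < del & forall x, D x -> dX0 x < del ->
    (E x + ((c - e) * dX0 x `^ q)%:E <= F x)%E.
Proof.
move=> e0 [r [/eqoP/(_ _ e0) rsmall EFr]].
have [del del0 H] := filterI rsmall EFr.
exists del => // x Dx xdel.
have [rx] := H x xdel Dx; apply: le_trans.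
rewrite leeD2l// lee_fin mulrBl lerD2l lerNl.
move: rx; rewrite [X in _ <= _ * X]ger0_norm ?powR_ge0//.
by apply: le_trans; rewrite -normrN ler_norm.
Qed.

Lemma local_stable_near0 (D : set X) (q c e : R) x : 0 < e ->
  (forall l, 0 < l -> D (l *: x)) -> local_stable E F d D q c ->
  exists2 del, 0 < del & forall l, 0 < l -> l < del ->
    (E x + ((c - e) * dX0 x `^ q * l `^ (q - p))%:E <= F x)%E.
Proof.
move=> e0 Dx /(local_stable_absorb _ _ _ _ e0)[del del0 H].
have D1 : 0 < dX0 x + 1 by rewrite ltr_wpDl// set_dist_ge0.
(* The added 1 keeps the denominator positive when [x] is at distance 0, and still yields
   [l * dX0 x < del]. *)
exists (del / (dX0 x + 1)); first exact: divr_gt0.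
move=> l l0; rewrite ltr_pdivlMr// => ldel.
rewrite -stable_ray//; apply: H; first exact: Dx.
by rewrite dX0Z// (lt_trans _ ldel)// ltr_pM2l// ltrDl.
Qed.

Lemma local_stable_global (c : R) :
  local_stable E F d setT p c -> global_stable E F d p c.
Proof.
move=> ls x; have D1 : 0 < dX0 x `^ p + 1 by rewrite ltr_wpDl// powR_ge0.
apply/lee_subgt0Pr => e e0.
have eD : 0 < e / (dX0 x `^ p + 1) by rewrite divr_gt0.
have [del del0 H] := local_stable_near0 _ _ _ _ x eD (fun _ _ => I) ls.
have /H : 0 < del / 2 by rewrite divr_gt0.
rewrite ltr_pdivrMr// ltr_pMr// ltr1n => /(_ isT).
(* With exponent [p] the factor in [l] is 1, so a single small [l] already gives the inequality at
   [x] itself. *)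
rewrite subrr powRr0 mulr1; apply: le_trans.
rewrite -EFinN -addeA leeD2l// lee_fin mulrBl lerD2l lerN2.
by rewrite mulrAC ler_pdivrMr// ler_pM2l// lerDl.
Qed.

Lemma deficit_bound (a : R) x : E x \is a fin_num -> F x \is a fin_num ->
  (E x + a%:E <= F x)%E -> a <= fine (F x) - fine (E x).
Proof.
by move=> /fineK <- /fineK <-; rewrite lee_fin lerBrDl.
Qed.

(** The deficit at [x] is a fixed real number, whereas for [q != p] a suitable dilation makes its
    lower bound arbitrarily large. *)
Lemma global_stable_exponent (q c : R) x :
  E x \is a fin_num -> F x \is a fin_num -> 0 < dX0 x -> 0 < c ->
  global_stable E F d q c -> q = p.
Proof.
move=> Ex Fx Dx c0 gs; apply/eqP; rewrite -subr_eq0; apply/negPn/negP => qp.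
have a0 : 0 < c * dX0 x `^ q by rewrite mulr_gt0// powR_gt0.
have [l l0] :=
  powR_unbounded _ _ ((fine (F x) - fine (E x)) / (c * dX0 x `^ q)) qp.
rewrite ltr_pdivrMr// mulrC ltNge => /negP; apply.
by apply: deficit_bound => //; rewrite -stable_ray//; exact: gs.
Qed.

Lemma local_stable_exponent (q c : R) x :
  E x \is a fin_num -> F x \is a fin_num -> 0 < dX0 x -> 0 < c ->
  local_stable E F d [set x | 0 < dX0 x] q c -> p <= q.
Proof.
move=> Ex Fx Dx c0 ls; rewrite leNgt; apply/negP; rewrite -subr_lt0 => qp.
(* Half of [c] pays for the remainder; the other half stays positive and, as [q - p < 0], its
   multiple blows up for small [l]. *)
have c2 : 0 < c / 2 by rewrite divr_gt0.
have ray l : 0 < l -> [set x | 0 < dX0 x] (l *: x).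
  by move=> l0 /=; rewrite dX0Z// mulr_gt0.
have [del del0 H] := local_stable_near0 _ _ _ _ x c2 ray ls.
have a0 : 0 < (c - c / 2) * dX0 x `^ q.
  by rewrite mulr_gt0 ?powR_gt0// {1}(splitr c) addrK.
have [l [l0 ldel]] := powR_unbounded_near0 _ _
  ((fine (F x) - fine (E x)) / ((c - c / 2) * dX0 x `^ q)) _ qp del0.
rewrite ltr_pdivrMr// mulrC ltNge => /negP; apply.
by apply: deficit_bound => //; exact: H.
Qed.

End stability.

Theorem theorem1p1 (R : realType) (X : lmodType R) (E F : X -> \bar R) (p : R)
    (d : X -> X -> R)
    (EF : forall x, (E x <= F x)%E)
    (sharp : optimizers E F !=set0)
    (homE : homogeneous p E)
    (homF : homogeneous p F)
    (dist_d : is_distance d)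
    (scale_d : scaling_distance d)
    (d_nontriv : exists x, set_dist d (optimizers E F) x != 0) :
  (* (i); the witness with finite values is automatic for real-valued E, F *)
  ((exists x, [/\ E x \is a fin_num, F x \is a fin_num
                & set_dist d (optimizers E F) x != 0]) ->
   forall q : R,
     (q != p -> ~ exists2 c : R, 0 < c & global_stable E F d q c) /\
     (q < p -> ~ exists2 c : R, 0 < c &
        local_stable E F d [set x | 0 < set_dist d (optimizers E F) x] q c)) /\
  (* (ii) *)
  ((forall c : R, 0 < c ->
      local_stable E F d setT p c -> global_stable E F d p c) /\
   (forall c0 : R,
      optimal_constant (local_stable E F d setT p) c0 ->
      optimal_constant (global_stable E F d p) c0)).
Proof.
have l2g c := local_stable_global _ _ _ _ _ _ homE homF dist_d scale_d sharp c.
split; last split.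
- move=> [x [Ex Fx Dx0]] q.
  have Dx : 0 < set_dist d (optimizers E F) x.
    by rewrite lt_neqAle eq_sym Dx0 set_dist_ge0.
  split=> [qp [c c0 gs]|qp [c c0 ls]].
    move/eqP: qp; apply.
    exact: (global_stable_exponent _ _ _ _ _ _ homE homF dist_d scale_d sharp
      _ _ _ Ex Fx Dx c0 gs).
  move: qp; rewrite ltNge => /negP; apply.
  exact: (local_stable_exponent _ _ _ _ _ _ homE homF dist_d scale_d sharp
    _ _ _ Ex Fx Dx c0 ls).
- by move=> c _; exact: l2g.
- move=> c0 [c0_gt0 ls c0_max]; split=> //; first exact: l2g.
  (* A global inequality is a local one with zero remainder, so every global constant competes with
     [c0] locally. *)
  by move=> c c_gt0 gs; apply: c0_max => //; exact: global_stable_local.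
Qed.
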